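(* Let $\phi$ be a formula and $\alpha$ a valuation such that the computation tree $[\![\phi]\!]_\alpha$ is determined. (i) If the existential closure $\exists(\phi^{\alpha})$ is true in $I$, then $[\![\phi]\!]_\alpha$ is successful. (ii) If $\exists(\phi^{\alpha})$ is false in $I$, then $[\![\phi]\!]_\alpha$ is failed.
   Context: Fix a first-order language with equality and an interpretation $I$ of it with domain $D$. A valuation is a finite single-valued set of pairs $x/d$ ($x$ a variable, $d\in D$); $\alpha'$ extends $\alpha$ if $\alpha\subseteq\alpha'$. A term $t$ is $\alpha$-closed if all its variables get a value in $\alpha$, and then $t^\alpha\in D$ is its value under $\alpha$; for an expression $E$, $E^\alpha$ is the result of replacing each $\alpha$-closed term $t$ in $E$ by (a name of) $t^\alpha$. A formula is $\alpha$-closed if all its free variables get a value in $\alpha$. An $\alpha$-assignment is an equation $s=t$ one side of which is a variable not assigned by $\alpha$ and the other side an $\alpha$-closed term. $\exists(\chi)$ denotes the existential closure of $\chi$. Formulas (no universal quantifier; conjunctions right-associative) are generated by: the empty conjunction $\Box$; $A\wedge\psi$ with $A$ an atom; $(\phi_1\vee\phi_2)\wedge\psi$; $(\phi_1\wedge\phi_2)\wedge\psi$; $(\phi_1\to\phi_2)\wedge\psi$; $\neg\phi\wedge\psi$; $\exists x\,\phi\wedge\psi$, where $\psi,\phi,\phi_1,\phi_2$ are formulas. The computation tree $[\![\phi]\!]_\alpha$ is a finite tree whose root is labelled $(\phi,\alpha)$, whose internal nodes are labelled by (formula, valuation) pairs, and whose leaves are labelled $\mathit{error}$, $\mathit{fail}$,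 or a valuation (a success leaf). It is defined by induction (lexicographically on the size of the formula and the size of its first conjunct): 1. $[\![\Box]\!]_\alpha$: the root has a single child, the success leaf $\alpha$. 2. $[\![A\wedge\psi]\!]_\alpha$, $A$ an atom: if $A$ is $\alpha$-closed and true in $I$ (under $\alpha$), the root's unique subtree is $[\![\psi]\!]_\alpha$; if $A$ is $\alpha$-closed and false, the root's unique child is $\mathit{fail}$; if $A$ is not $\alpha$-closed and not an $\alpha$-assignment, the unique child is $\mathit{error}$; if $A$ is an $\alpha$-assignment $x=t$ or $t=x$ with $x$ not assigned by $\alpha$ and $t$ $\alpha$-closed, the unique subtree is $[\![\psi]\!]_{\alpha\cup\{x/t^\alpha\}}$. 3. $[\![(\phi_1\vee\phi_2)\wedge\psi]\!]_\alpha$: root with two subtrees $[\![\phi_1\wedge\psi]\!]_\alpha$ and $[\![\phi_2\wedge\psi]\!]_\alpha$. 4. $[\![(\phi_1\wedge\phi_2)\wedge\psi]\!]_\alpha$: root with unique subtree $[\![\phi_1\wedge(\phi_2\wedge\psi)]\!]_\alpha$. 5. $[\![(\phi_1\to\phi_2)\wedge\psi]\!]_\alpha$: if $\phi_1$ is $\alpha$-closed and $[\![\phi_1]\!]_\alpha$ has only $\mathit{fail}$ leaves, unique subtree $[\![\psi]\!]_\alpha$; if $\phi_1$ is $\alpha$-closed and $[\![\phi_1]\!]_\alpha$ contains a success leaf, unique subtree $[\![\phi_2\wedge\psi]\!]_\alpha$; otherwise unique child $\mathit{error}$. 6. $[\![\neg\phi\wedge\psi]\!]_\alpha$: if $\phi$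 is $\alpha$-closed and $[\![\phi]\!]_\alpha$ has only $\mathit{fail}$ leaves, unique subtree $[\![\psi]\!]_\alpha$; if $\phi$ is $\alpha$-closed and $[\![\phi]\!]_\alpha$ contains a success leaf, unique child $\mathit{fail}$; otherwise unique child $\mathit{error}$. 7. $[\![\exists x\,\phi\wedge\psi]\!]_\alpha$, where the bound variable $x$ is (after renaming) fresh, i.e. not in the domain of $\alpha$ and not occurring in $\psi$: unique subtree $[\![\phi\wedge\psi]\!]_\alpha$. A computation tree is successful if it contains a success leaf, failed if it contains only $\mathit{fail}$ leaves, and determined if it is successful or failed. *)

(* Defs.v *)
From Stdlib Require List.
From mathcomp Require Import all_boot finmap.

Set Implicit Arguments.
Unset Strict Implicit.
Unset Printing Implicit Defensive.

Local Open Scope fset_scope.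
Local Open Scope fmap_scope.

Record signature := Signature {
  fsym : Type; farity : fsym -> nat;
  rsym : Type; rarity : rsym -> nat }.

Definition var := nat.

Inductive term (S : signature) :=
| Var (x : var)
| App (f : fsym S) (ts : 'I_(farity f) -> term S).

Arguments Var {S} x.

Inductive atom (S : signature) :=
| Rel (r : rsym S) (ts : 'I_(rarity r) -> term S)
| Equ (s t : term S).

(* Every formula is a right-nested conjunction ending with the empty
   conjunction: the last argument of each constructor is the rest of the
   conjunction, so that [Or p1 p2 q] stands for (p1 \/ p2) /\ q. *)
Inductive formula (S : signature) :=
| Box
| Atom (A : atom S) (q : formula S)
| Or (p1 p2 q : formula S)
| And (p1 p2 q : formula S)
| Imp (p1 p2 q : formula S)
| Not (p q : formula S)
| Ex (x : var) (p q : formula S).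

Arguments Box {S}.

(* The conjunction p /\ q of two formulas, as a formula: it is the right-nested
   conjunction of the conjuncts of p followed by those of q. *)
Fixpoint fconj S (p q : formula S) : formula S :=
  match p with
  | Box => q
  | Atom A r => Atom A (fconj r q)
  | Or p1 p2 r => Or p1 p2 (fconj r q)
  | And p1 p2 r => And p1 p2 (fconj r q)
  | Imp p1 p2 r => Imp p1 p2 (fconj r q)
  | Not p1 r => Not p1 (fconj r q)
  | Ex x p1 r => Ex x p1 (fconj r q)
  end.

Fixpoint tvars S (t : term S) : seq var :=
  match t with
  | Var x => [:: x]
  | App f ts => flatten [seq tvars (ts i) | i <- enum 'I_(farity f)]
  end.

Definition avars S (A : atom S) : seq var :=
  match A with
  | Rel r ts => flatten [seq tvars (ts i) | i <- enum 'I_(rarity r)]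
  | Equ s t => tvars s ++ tvars t
  end.

Fixpoint free_vars S (p : formula S) : seq var :=
  match p with
  | Box => [::]
  | Atom A q => avars A ++ free_vars q
  | Or p1 p2 q | And p1 p2 q | Imp p1 p2 q =>
      free_vars p1 ++ free_vars p2 ++ free_vars q
  | Not p1 q => free_vars p1 ++ free_vars q
  | Ex x p1 q => [seq y <- free_vars p1 | y != x] ++ free_vars q
  end.

(* All variables occurring in a formula: free, bound or quantified. *)
Fixpoint all_vars S (p : formula S) : seq var :=
  match p with
  | Box => [::]
  | Atom A q => avars A ++ all_vars q
  | Or p1 p2 q | And p1 p2 q | Imp p1 p2 q =>
      all_vars p1 ++ all_vars p2 ++ all_vars q
  | Not p1 q => all_vars p1 ++ all_vars q
  | Ex x p1 q => x :: all_vars p1 ++ all_vars q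
  end.

Fixpoint trename S (x y : var) (t : term S) : term S :=
  match t with
  | Var z => Var (if z == x then y else z)
  | App f ts => App (fun i => trename x y (ts i))
  end.

Definition arename S (x y : var) (A : atom S) : atom S :=
  match A with
  | Rel r ts => Rel (fun i => trename x y (ts i))
  | Equ s t => Equ (trename x y s) (trename x y t)
  end.

(* Replaces the free occurrences of x by y; this is only meant to be used
   when y = x or y does not occur in p, so that no capture can arise. *)
Fixpoint rename S (x y : var) (p : formula S) : formula S :=
  match p with
  | Box => Box
  | Atom A q => Atom (arename x y A) (rename x y q)
  | Or p1 p2 q => Or (rename x y p1) (rename x y p2) (rename x y q)
  | And p1 p2 q => And (rename x y p1) (rename x y p2) (rename x y q)
  | Imp p1 p2 q => Imp (rename x y p1) (rename x y p2) (rename x y q)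
  | Not p1 q => Not (rename x y p1) (rename x y q)
  | Ex z p1 q => Ex z (if z == x then p1 else rename x y p1) (rename x y q)
  end.

(* [point] records that domains are nonempty. *)
Record interpretation (S : signature) := Interpretation {
  dom :> Type;
  point : dom;
  ifun : forall f : fsym S, (farity f).-tuple dom -> dom;
  irel : forall r : rsym S, (rarity r).-tuple dom -> Prop }.

Fixpoint teval S (I : interpretation S) (rho : var -> I) (t : term S) : I :=
  match t with
  | Var x => rho x
  | App f ts => ifun [tuple teval rho (ts i) | i < farity f]
  end.

Definition asat S (I : interpretation S) (rho : var -> I) (A : atom S) : Prop :=
  match A with
  | Rel r ts => irel [tuple teval rho (ts i) | i < rarity r]
  | Equ s t => teval rho s = teval rho t
  end.

Fixpoint sat S (I : interpretation S) (rho : var -> I) (p : formula S) : Prop :=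
  match p with
  | Box => True
  | Atom A q => asat rho A /\ sat rho q
  | Or p1 p2 q => (sat rho p1 \/ sat rho p2) /\ sat rho q
  | And p1 p2 q => (sat rho p1 /\ sat rho p2) /\ sat rho q
  | Imp p1 p2 q => (sat rho p1 -> sat rho p2) /\ sat rho q
  | Not p1 q => ~ sat rho p1 /\ sat rho q
  | Ex x p1 q => (exists d : I, sat [eta rho with x |-> d] p1) /\ sat rho q
  end.

Definition true_in S (I : interpretation S) (p : formula S) : Prop :=
  forall rho : var -> I, sat rho p.

Definition ex_closure S (p : formula S) : formula S :=
  foldr (fun x q => Ex x q Box) p (undup (free_vars p)).

Notation valuation D := {fmap var -> D}.

Definition term_closed S D (a : valuation D) (t : term S) : bool :=
  all (mem (domf a)) (tvars t).

Definition atom_closed S D (a : valuation D) (A : atom S) : bool :=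
  all (mem (domf a)) (avars A).

Definition formula_closed S D (a : valuation D) (p : formula S) : bool :=
  all (mem (domf a)) (free_vars p).

(* The default value [point I] is irrelevant for expressions all of whose free
   variables are in the domain of the valuation. *)
Definition totalize S (I : interpretation S) (a : valuation I) (x : var) : I :=
  odflt (point I) a.[? x].

Definition term_val S (I : interpretation S) (a : valuation I) (t : term S) : I :=
  teval (totalize a) t.

Definition atom_true S (I : interpretation S) (a : valuation I) (A : atom S) : Prop :=
  asat (totalize a) A.

(* The language extended with a constant, [name d], for each d in D. *)
Definition name_sig (S : signature) (D : Type) : signature :=
  {| fsym := fsym S + D;
     farity := fun s => match s with inl f => farity f | inr _ => 0 end;
     rsym := rsym S;
     rarity := @rarity S |}.

Definition name S D (d : D) : term (name_sig S D) :=
  @App (name_sig S D) (inr d) (fun i => False_rect _ (notF (ltn_ord i))).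

Definition name_interp S (I : interpretation S) :
    interpretation (name_sig S I) :=
  @Interpretation (name_sig S I) I (point I)
    (fun s => match s return (@farity (name_sig S I) s).-tuple I -> I with
              | inl f => @ifun S I f
              | inr d => fun=> d
              end)
    (@irel S I).

(* The next three functions replace the a-closed terms of an expression E by
   the names of their values, giving E^a. *)
Fixpoint tinst S (I : interpretation S) (a : valuation I) (t : term S) :
    term (name_sig S I) :=
  if term_closed a t then name S (term_val a t) else
  match t with
  | Var x => Var x
  | App f ts => @App (name_sig S I) (inl f) (fun i => tinst a (ts i))
  end.

Definition ainst S (I : interpretation S) (a : valuation I) (A : atom S) :
    atom (name_sig S I) :=
  match A with
  | Rel r ts => @Rel (name_sig S I) r (fun i => tinst a (ts i))
  | Equ s t => Equ (tinst a s) (tinst a t)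
  end.

(* Bound occurrences of a variable are not replaced, whence the restriction of
   the valuation below a quantifier. *)
Fixpoint inst S (I : interpretation S) (a : valuation I) (p : formula S) :
    formula (name_sig S I) :=
  match p with
  | Box => Box
  | Atom A q => Atom (ainst a A) (inst a q)
  | Or p1 p2 q => Or (inst a p1) (inst a p2) (inst a q)
  | And p1 p2 q => And (inst a p1) (inst a p2) (inst a q)
  | Imp p1 p2 q => Imp (inst a p1) (inst a p2) (inst a q)
  | Not p1 q => Not (inst a p1) (inst a q)
  | Ex x p1 q => Ex x (inst a.[~ x] p1) (inst a q)
  end.

(* A is an a-assignment, of the term t to the variable x. *)
Definition assignment S D (a : valuation D) (A : atom S) (x : var) (t : term S)
    : Prop :=
  [/\ A = Equ (Var x) t \/ A = Equ t (Var x), x \notin domf a & term_closed a t].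

Inductive leaf (D : Type) := Error | Fail | Success (a : valuation D).

Arguments Error {D}.
Arguments Fail {D}.

Inductive tree (S : signature) (D : Type) :=
| Leaf (l : leaf D)
| Node (p : formula S) (a : valuation D) (Ts : seq (tree S D)).

Arguments Leaf {S D} l.

Fixpoint leaves S D (T : tree S D) : seq (leaf D) :=
  match T with
  | Leaf l => [:: l]
  | Node _ _ Ts => flatten [seq leaves T' | T' <- Ts]
  end.

Definition successful S D (T : tree S D) : Prop :=
  exists a : valuation D, List.In (Success a) (leaves T).

Definition failed S D (T : tree S D) : Prop :=
  forall l : leaf D, List.In l (leaves T) -> l = Fail.

Definition determined S D (T : tree S D) : Prop := successful T \/ failed T.

(* [comp_tree p a T]: T is the computation tree of p at a.  The tree is unique
   only up to the choice of the fresh bound variables, made in [CT_ex], hence a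
   relation: any variable y that is not in the domain of a and does not occur in
   the rest of the conjunction may be used, provided that renaming x to y is a
   legitimate renaming of the bound variable (possibly the identity). *)
Inductive comp_tree S (I : interpretation S) :
    formula S -> valuation I -> tree S I -> Prop :=
| CT_box a :
    comp_tree Box a (Node Box a [:: Leaf (Success a)])
| CT_atom_true A q a T :
    atom_closed a A -> atom_true a A -> comp_tree q a T ->
    comp_tree (Atom A q) a (Node (Atom A q) a [:: T])
| CT_atom_false A q a :
    atom_closed a A -> ~ atom_true a A ->
    comp_tree (Atom A q) a (Node (Atom A q) a [:: Leaf Fail])
| CT_atom_error A q a :
    ~~ atom_closed a A -> (forall x t, ~ assignment a A x t) ->
    comp_tree (Atom A q) a (Node (Atom A q) a [:: Leaf Error])
| CT_atom_assign A q a x t T :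
    assignment a A x t -> comp_tree q a.[x <- term_val a t] T ->
    comp_tree (Atom A q) a (Node (Atom A q) a [:: T])
| CT_or p1 p2 q a T1 T2 :
    comp_tree (fconj p1 q) a T1 -> comp_tree (fconj p2 q) a T2 ->
    comp_tree (Or p1 p2 q) a (Node (Or p1 p2 q) a [:: T1; T2])
| CT_and p1 p2 q a T :
    comp_tree (fconj p1 (fconj p2 q)) a T ->
    comp_tree (And p1 p2 q) a (Node (And p1 p2 q) a [:: T])
| CT_imp_failed p1 p2 q a T1 T :
    formula_closed a p1 -> comp_tree p1 a T1 -> failed T1 -> comp_tree q a T ->
    comp_tree (Imp p1 p2 q) a (Node (Imp p1 p2 q) a [:: T])
| CT_imp_successful p1 p2 q a T1 T :
    formula_closed a p1 -> comp_tree p1 a T1 -> successful T1 ->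
    comp_tree (fconj p2 q) a T ->
    comp_tree (Imp p1 p2 q) a (Node (Imp p1 p2 q) a [:: T])
| CT_imp_not_closed p1 p2 q a :
    ~~ formula_closed a p1 ->
    comp_tree (Imp p1 p2 q) a (Node (Imp p1 p2 q) a [:: Leaf Error])
| CT_imp_undetermined p1 p2 q a T1 :
    formula_closed a p1 -> comp_tree p1 a T1 -> ~ determined T1 ->
    comp_tree (Imp p1 p2 q) a (Node (Imp p1 p2 q) a [:: Leaf Error])
| CT_not_failed p q a T1 T :
    formula_closed a p -> comp_tree p a T1 -> failed T1 -> comp_tree q a T ->
    comp_tree (Not p q) a (Node (Not p q) a [:: T])
| CT_not_successful p q a T1 :
    formula_closed a p -> comp_tree p a T1 -> successful T1 ->
    comp_tree (Not p q) a (Node (Not p q) a [:: Leaf Fail])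
| CT_not_not_closed p q a :
    ~~ formula_closed a p ->
    comp_tree (Not p q) a (Node (Not p q) a [:: Leaf Error])
| CT_not_undetermined p q a T1 :
    formula_closed a p -> comp_tree p a T1 -> ~ determined T1 ->
    comp_tree (Not p q) a (Node (Not p q) a [:: Leaf Error])
| CT_ex x y p q a T :
    y \notin domf a -> y \notin all_vars q -> (y == x) || (y \notin all_vars p) ->
    comp_tree (fconj (rename x y p) q) a T ->
    comp_tree (Ex x p q) a (Node (Ex x p q) a [:: T]).

(* Main.v *)
Require Import Defs.
From mathcomp Require Import all_boot finmap.

(* A valuation [a] stands for the set of all total assignments that extend it.
   By induction on its construction, a computation tree containing a success
   leaf yields an extension of [a] satisfying the formula, while a failed tree
   excludes every such extension; the guards of implications and negations are
   closed, so that all extensions agree on them.  The satisfying extensions of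
   [a] are in turn the witnesses of the existential closure of the instance. *)

Set Implicit Arguments.
Unset Strict Implicit.
Unset Printing Implicit Defensive.

Local Open Scope fset_scope.
Local Open Scope fmap_scope.

(** * Coincidence, renaming and existential closure under total assignments *)

Section Satisfaction.

Variables (S : signature) (I : interpretation S).
Implicit Types (rho : var -> I) (t : term S) (A : atom S) (p q : formula S).

Lemma eq_in_teval rho1 rho2 t :
  {in tvars t, rho1 =1 rho2} -> teval rho1 t = teval rho2 t.
Proof.
elim: t => [x|f ts IH] /= eq_rho; first by apply: eq_rho; rewrite inE.
congr (ifun _); apply: eq_mktuple => i; apply: IH => x xi.
by apply: eq_rho; apply/flatten_mapP; exists i; rewrite ?mem_enum.
Qed.

Lemma eq_in_asat rho1 rho2 A :
  {in avars A, rho1 =1 rho2} -> asat rho1 A <-> asat rho2 A.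
Proof.
case: A => [r ts|s t] /= eq_rho.
  suff -> : [tuple teval rho1 (ts i) | i < rarity r]
          = [tuple teval rho2 (ts i) | i < rarity r] by [].
  apply: eq_mktuple => i; apply: eq_in_teval => x xi.
  by apply: eq_rho; apply/flatten_mapP; exists i; rewrite ?mem_enum.
have E u : {subset tvars u <= tvars s ++ tvars t} ->
    teval rho1 u = teval rho2 u.
  by move=> sub; apply: eq_in_teval => x /sub/eq_rho.
by rewrite !E // => x xu; rewrite mem_cat xu ?orbT.
Qed.

Lemma eq_in_sat rho1 rho2 p :
  {in free_vars p, rho1 =1 rho2} -> sat rho1 p <-> sat rho2 p.
Proof.
elim: p rho1 rho2 => [|A q IH|p1 IH1 p2 IH2 q IH|p1 IH1 p2 IH2 q IH
    |p1 IH1 p2 IH2 q IH|p1 IH1 q IH|x p1 IH1 q IH] //= rho1 rho2 eq_rho.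
- have := @eq_in_asat rho1 rho2 A; have := IH rho1 rho2.
  by move=> -> => [->|y yq] // => [y yA|]; apply: eq_rho;
    rewrite mem_cat ?yA ?yq ?orbT.
- rewrite (IH1 rho1 rho2) ?(IH2 rho1 rho2) ?(IH rho1 rho2) // => y yp;
    by apply: eq_rho; rewrite !mem_cat yp ?orbT.
- rewrite (IH1 rho1 rho2) ?(IH2 rho1 rho2) ?(IH rho1 rho2) // => y yp;
    by apply: eq_rho; rewrite !mem_cat yp ?orbT.
- rewrite (IH1 rho1 rho2) ?(IH2 rho1 rho2) ?(IH rho1 rho2) // => y yp;
    by apply: eq_rho; rewrite !mem_cat yp ?orbT.
- rewrite (IH1 rho1 rho2) ?(IH rho1 rho2) // => y yp;
    by apply: eq_rho; rewrite !mem_cat yp ?orbT.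
- rewrite (IH rho1 rho2); last first.
    by move=> y yq; apply: eq_rho; rewrite mem_cat yq orbT.
  have E d : sat [eta rho1 with x |-> d] p1 <-> sat [eta rho2 with x |-> d] p1.
    apply: IH1 => y yp /=; case: eqP => // /eqP yx.
    by apply: eq_rho; rewrite mem_cat mem_filter yx yp.
  by split=> -[[d /E dp] ?]; split=> //; exists d.
Qed.

Lemma eq_sat rho1 rho2 p : rho1 =1 rho2 -> sat rho1 p <-> sat rho2 p.
Proof. by move=> eq_rho; apply: eq_in_sat => x _. Qed.

Lemma sat_fconj rho p q : sat rho (fconj p q) <-> sat rho p /\ sat rho q.
Proof. by elim: p => [|A p IH|p1 _ p2 _ p IH|p1 _ p2 _ p IH|p1 _ p2 _ p IH
    |p1 _ p IH|x p1 _ p IH] /=; rewrite ?IH; tauto. Qed.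

Lemma free_vars_all p : {subset free_vars p <= all_vars p}.
Proof.
elim: p => [|A q IH|p1 IH1 p2 IH2 q IH|p1 IH1 p2 IH2 q IH
    |p1 IH1 p2 IH2 q IH|p1 IH1 q IH|x p1 IH1 q IH] y //=;
  rewrite ?inE !mem_cat ?mem_filter.
- by case/orP=> [->|/IH->]; rewrite ?orbT.
- by case/or3P=> [/IH1->|/IH2->|/IH->]; rewrite ?orbT.
- by case/or3P=> [/IH1->|/IH2->|/IH->]; rewrite ?orbT.
- by case/or3P=> [/IH1->|/IH2->|/IH->]; rewrite ?orbT.
- by case/orP=> [/IH1->|/IH->]; rewrite ?orbT.
- by case/orP=> [/andP[_ /IH1->]|/IH->]; rewrite ?orbT.
Qed.

Lemma teval_trename rho x y t :
  teval rho (trename x y t) = teval [eta rho with x |-> rho y] t.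
Proof.
elim: t => [z|f ts IH] /=; first by case: eqP.
by congr (ifun _); apply: eq_mktuple => i; apply: IH.
Qed.

Lemma asat_arename rho x y A :
  asat rho (arename x y A) <-> asat [eta rho with x |-> rho y] A.
Proof.
case: A => [r ts|s t] /=; last by rewrite !teval_trename.
suff -> : [tuple teval rho (trename x y (ts i)) | i < rarity r]
  = [tuple teval [eta rho with x |-> rho y] (ts i) | i < rarity r] by [].
by apply: eq_mktuple => i; apply: teval_trename.
Qed.

(** In the quantifier case with [z == x] the inner update masks the outer one. Otherwise the
    hypothesis on [y] forces [y != z], so no capture occurs: the update at [z] leaves the value of
    [y] intact and commutes with the update at [x]. *)
Lemma sat_rename rho x y p : (y == x) || (y \notin all_vars p) ->
  sat rho (rename x y p) <-> sat [eta rho with x |-> rho y] p.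
Proof.
elim: p rho => [|A q IH|p1 IH1 p2 IH2 q IH|p1 IH1 p2 IH2 q IH
    |p1 IH1 p2 IH2 q IH|p1 IH1 q IH|z p1 IH1 q IH] //= rho;
  rewrite ?inE ?mem_cat ?negb_or => yP.
- by rewrite asat_arename IH //; case: eqP yP => //= _ /andP[].
- by rewrite IH1 ?IH2 ?IH //; case: eqP yP => //= _ /and3P[].
- by rewrite IH1 ?IH2 ?IH //; case: eqP yP => //= _ /and3P[].
- by rewrite IH1 ?IH2 ?IH //; case: eqP yP => //= _ /and3P[].
- by rewrite IH1 ?IH //; case: eqP yP => //= _ /andP[].
rewrite IH; last by case: eqP yP => //= _ /and3P[].
have E d : sat [eta rho with z |-> d] (if z == x then p1 else rename x y p1)
    <-> sat [eta [eta rho with x |-> rho y] with z |-> d] p1.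
  case: (eqVneq z x) => [->|zx].
    by apply: eq_sat => u /=; case: eqP.
  rewrite IH1; last by case: eqP yP => //= _ /and3P[].
  apply: eq_sat => u /=; case: (eqVneq u x) => [->|//].
  rewrite [x == z]eq_sym (negbTE zx); case: (eqVneq y z) => // yz.
  by move: yP; rewrite yz (negbTE zx) eqxx.
by split=> -[[d /E dp] ?]; split=> //; exists d.
Qed.

Lemma sat_foldr_Ex rho (s : seq var) p :
  sat rho (foldr (fun x q => Ex x q Box) p s) <->
  exists2 rho' : var -> I, (forall x, x \notin s -> rho' x = rho x) & sat rho' p.
Proof.
elim: s rho => [|x s IH] rho /=.
  split=> [|[rho' eq_rho]]; first by exists rho.
  by apply: (proj1 (eq_sat _ _)) => x; apply: eq_rho.
split=> [[[d /IH[rho' eq_rho rho'p]] _]|[rho' eq_rho rho'p]].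
  exists rho' => // y; rewrite inE negb_or => /andP[yx /eq_rho ->] /=.
  by rewrite (negbTE yx).
split=> //; exists (rho' x); apply/IH; exists rho' => // y ys /=.
by case: eqVneq => [->//|yx]; apply: eq_rho; rewrite inE negb_or yx.
Qed.

Lemma true_in_ex_closure p :
  true_in I (ex_closure p) <-> exists rho : var -> I, sat rho p.
Proof.
(* [point I] supplies one assignment at which to use the truth of the closure. *)
split=> [/(_ (fun=> point I))/sat_foldr_Ex[rho _ rhop]|[rho rhop] rho1].
  by exists rho.
apply/sat_foldr_Ex.
(* Only the quantified variables may depart from [rho1], and the truth of [p] depends on these
   alone. *)
exists (fun x => if x \in free_vars p then rho x else rho1 x).
  by move=> x; rewrite mem_undup => /negbTE->.
by move: rhop; apply: (proj1 (eq_in_sat _)) => x /= ->.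
Qed.

End Satisfaction.

(** * Total assignments extending a valuation *)

Section Valuations.

Variables (S : signature) (I : interpretation S).
Implicit Types (rho : var -> I) (a : valuation I) (p : formula S).

(** Values off [domf a] are unconstrained, so the default value in [totalize] never matters. *)
Definition extends rho a := {in domf a, rho =1 totalize a}.

Lemma extends_set a x d rho : x \notin domf a ->
  extends rho a.[x <- d] <-> extends rho a /\ rho x = d.
Proof.
move=> xa; split=> [ext|[ext rhox] y].
  split=> [y ya|]; last first.
    by rewrite ext ?inE ?eqxx // /totalize fnd_set eqxx.
  have yx : y != x by apply: contraNneq xa => <-.
  by rewrite ext ?inE ?ya ?orbT // /totalize fnd_set (negbTE yx).
rewrite /totalize fnd_set inE; case: eqVneq => [->|yx /= ya]; first by rewrite rhox.
by apply: ext; move: ya; rewrite inE (negbTE yx).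
Qed.

Lemma sat_closed a rho p : formula_closed a p -> extends rho a ->
  sat rho p <-> sat (totalize a) p.
Proof. by move=> /allP cl ext; apply: eq_in_sat => x /cl/ext. Qed.

Lemma asat_closed a rho (A : atom S) : atom_closed a A -> extends rho a ->
  asat rho A <-> atom_true a A.
Proof. by move=> /allP cl ext; apply: eq_in_asat => x /cl/ext. Qed.

Lemma teval_closed a rho (t : term S) : term_closed a t -> extends rho a ->
  teval rho t = term_val a t.
Proof. by move=> /allP cl ext; apply: eq_in_teval => x /cl/ext. Qed.

(** Since [t] is closed, it has the value [term_val a t] under every extension of [a]; there the
    equation [A] says just that [x] has this value. *)
Lemma extends_assignment a (A : atom S) x t rho : assignment a A x t ->
  extends rho a.[x <- term_val a t] <-> extends rho a /\ asat rho A.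
Proof.
case=> defA xa cl; rewrite extends_set //.
have E : extends rho a -> asat rho A <-> rho x = term_val a t.
  by move=> ext; rewrite -(teval_closed cl ext); case: defA => -> /=; split.
by split=> -[ext /(E ext)].
Qed.

(** The semantic counterpart of the existential closure of [inst a p]; [true_in_closure_inst]
    relates the two. *)
Definition satisfiable_at a p := exists2 rho : var -> I, extends rho a & sat rho p.

Lemma satisfiable_at_closed a p : formula_closed a p ->
  satisfiable_at a p <-> sat (totalize a) p.
Proof.
move=> cl; split=> [[rho ext /(sat_closed cl ext)] //|].
by exists (totalize a).
Qed.

(** The quantifier moves out over [q]: as [y] is fresh for [a] and [q], storing the witness in [y]
    still extends [a] and keeps [q] true. Conversely, the value of [y] is a witness for [x]. *)
Lemma satisfiable_at_Ex a x y p q :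
  y \notin domf a -> y \notin all_vars q -> (y == x) || (y \notin all_vars p) ->
  satisfiable_at a (Ex x p q) <-> satisfiable_at a (fconj (rename x y p) q).
Proof.
move=> ya yq yp; split=> -[rho ext].
  case=> -[d dp] qrho; exists [eta rho with y |-> d].
    move=> z za /=; case: eqVneq => [zy|_]; last exact: ext.
    by rewrite -zy za in ya.
  apply/sat_fconj; split.
    apply/sat_rename => //=; rewrite eqxx; move: dp.
    apply: (proj1 (eq_in_sat _)) => z zp /=; case: (eqVneq z x) => // zx.
    case: eqVneq => // zy; move: yp; rewrite -zy (negbTE zx) /=.
    by rewrite (free_vars_all zp).
  move: qrho; apply: (proj1 (eq_in_sat _)) => z zq /=.
  by case: eqVneq => // zy; rewrite -zy (free_vars_all zq) in yq.
move=> /sat_fconj[/sat_rename rhop rhoq]; exists rho => //=.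
by split=> //; exists (rho y); apply: rhop.
Qed.

(** * Instances under total assignments *)

Definition override a rho x := odflt (rho x) a.[? x].

Lemma override_id a rho : extends rho a -> override a rho =1 rho.
Proof.
move=> ext x; rewrite /override; case: (boolP (x \in domf a)) => xa.
  by rewrite ext // /totalize in_fnd.
by rewrite not_fnd.
Qed.

Lemma extends_override a rho : extends (override a rho) a.
Proof. by move=> x xa; rewrite /override /totalize in_fnd. Qed.

(** The names in the instance fix the values coming from [a], and [rho] decides elsewhere, which is
    what [override] records. A closed term takes its value from [a] alone. *)
Lemma teval_tinst a rho (t : term S) :
  @teval _ (name_interp I) rho (tinst a t) = teval (override a rho) t.
Proof.
elim: t => [x|f ts IH]; rewrite /tinst -/tinst; case: ifP => cl.
- by rewrite (teval_closed cl (@extends_override a rho)).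
- by rewrite /= /override not_fnd //; move: cl; rewrite /term_closed /= andbT => ->.
- by rewrite (teval_closed cl (@extends_override a rho)).
- by rewrite /=; congr (ifun _); apply: eq_mktuple => i; apply: IH.
Qed.

Lemma asat_ainst a rho (A : atom S) :
  @asat _ (name_interp I) rho (ainst a A) <-> asat (override a rho) A.
Proof.
case: A => [r ts|s t] /=; last by rewrite !teval_tinst.
set u := mktuple _; set v := mktuple _.
suff -> : u = v by [].
by apply: eq_mktuple => i; apply: teval_tinst.
Qed.

Lemma sat_inst a rho p :
  @sat _ (name_interp I) rho (inst a p) <-> sat (override a rho) p.
Proof.
elim: p a rho => [|A q IH|p1 IH1 p2 IH2 q IH|p1 IH1 p2 IH2 q IH
    |p1 IH1 p2 IH2 q IH|p1 IH1 q IH|x p1 IH1 q IH] //= a rho;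
  rewrite ?asat_ainst ?IH1 ?IH2 ?IH //.
(* Dropping [x] from [a] lets the quantified value [d] win over any value that [a] gives to [x]. *)
have E d : @sat _ (name_interp I) [eta rho with x |-> d] (inst a.[~ x] p1)
    <-> sat [eta override a rho with x |-> d] p1.
  rewrite IH1; apply: eq_sat => y; rewrite /override /= fnd_rem1.
  by case: eqVneq.
by split=> -[[d /E dp] ?]; split=> //; exists d.
Qed.

(** Overriding turns a witness for the instance into an extension of [a], and does not change an
    assignment that already extends [a]. *)
Lemma true_in_closure_inst a p :
  true_in (name_interp I) (ex_closure (inst a p)) <-> satisfiable_at a p.
Proof.
rewrite true_in_ex_closure; split=> [[rho /sat_inst]|[rho ext rhop]].
  by exists (override a rho) => //; apply: extends_override.
by exists rho; apply/sat_inst/(eq_sat _ (override_id ext)).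
Qed.

(** * Soundness of computation trees *)

Lemma successful_Node1 p a (T : tree S I) :
  successful (Node p a [:: T]) <-> successful T.
Proof. by rewrite /successful /= cats0. Qed.

Lemma failed_Node1 p a (T : tree S I) :
  failed (Node p a [:: T]) <-> failed T.
Proof. by rewrite /failed /= cats0. Qed.

Lemma successful_Node2 p a (T1 T2 : tree S I) :
  successful (Node p a [:: T1; T2]) <-> successful T1 \/ successful T2.
Proof.
rewrite /successful /= cats0; split.
  by case=> b /List.in_app_iff[?|?]; [left|right]; exists b.
by case=> -[b bT]; exists b; apply/List.in_app_iff; [left|right].
Qed.

Lemma failed_Node2 p a (T1 T2 : tree S I) :
  failed (Node p a [:: T1; T2]) <-> failed T1 /\ failed T2.
Proof.
rewrite /failed /= cats0; split=> [H|[H1 H2] l /List.in_app_iff[/H1|/H2] //].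
by split=> l lT; apply/H/List.in_app_iff; [left|right].
Qed.

Lemma not_successful_Leaf (l : leaf I) :
  (forall b, l <> Success b) -> ~ successful (Leaf l : tree S I).
Proof. by move=> lP [b [/lP|]]. Qed.

Lemma failed_Leaf (l : leaf I) : failed (Leaf l : tree S I) -> l = Fail.
Proof. by apply; left. Qed.

(** The two halves go through the induction together, because negation exchanges success and failure
    of its guard. An undetermined tree satisfies both vacuously. *)
Definition sound p a (T : tree S I) :=
  (successful T -> satisfiable_at a p) /\ (failed T -> ~ satisfiable_at a p).

Lemma sound_step p a p' a' T : satisfiable_at a p <-> satisfiable_at a' p' ->
  sound p' a' T -> sound p a (Node p a [:: T]).
Proof. by rewrite /sound successful_Node1 failed_Node1 => ->. Qed.

Lemma sound_error p a : sound p a (Node p a [:: Leaf Error]).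
Proof.
rewrite /sound successful_Node1 failed_Node1.
by split=> [/not_successful_Leaf|/failed_Leaf] // [].
Qed.

Lemma sound_fail p a : ~ satisfiable_at a p -> sound p a (Node p a [:: Leaf Fail]).
Proof.
rewrite /sound successful_Node1 => np.
by split=> // /not_successful_Leaf[].
Qed.

Lemma eq_satisfiable_at a p q :
  (forall rho, extends rho a -> sat rho p <-> sat rho q) ->
  satisfiable_at a p <-> satisfiable_at a q.
Proof. by move=> E; split=> -[rho ext /(E rho ext)]; exists rho. Qed.

Lemma comp_tree_sound p a T : comp_tree p a T -> sound p a T.
Proof.
(* Success only yields some extension satisfying the guard; closedness spreads this to all of
   them. *)
have sat_guard q b rho T1 : formula_closed b q -> sound q b T1 ->
    successful T1 -> extends rho b -> sat rho q.
  move=> cl [sT1 _] /sT1/(satisfiable_at_closed cl) qb ext.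
  exact/(sat_closed cl ext).
have unsat_guard q b rho T1 : sound q b T1 -> failed T1 ->
    extends rho b -> ~ sat rho q.
  by move=> [_ fT1] /fT1 nq ext rhoq; apply: nq; exists rho.
elim=> {p a T}.
- move=> a; rewrite /sound failed_Node1; split=> [_|/failed_Leaf //].
  by exists (totalize a).
- move=> A q a T cl tA _; apply: sound_step; apply: eq_satisfiable_at => rho ext /=.
  by rewrite (asat_closed cl ext); tauto.
- move=> A q a cl nA; apply: sound_fail => -[rho ext /= [/(asat_closed cl ext)]].
  by move/nA.
- by move=> *; apply: sound_error.
- move=> A q a x t T asg _; apply: sound_step; split.
    move=> [rho ext /= [rhoA rhoq]]; exists rho => //.
    by apply/(extends_assignment _ asg).
  by move=> [rho /(extends_assignment _ asg)[ext rhoA] rhoq]; exists rho.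
- move=> p1 p2 q a T1 T2 _ [s1 f1] _ [s2 f2].
  rewrite /sound successful_Node2 failed_Node2; split.
    by case=> [/s1|/s2] -[rho ext /sat_fconj[]]; exists rho => //=; tauto.
  move=> [/f1 n1 /f2 n2] [rho ext /= [[rhop|rhop] rhoq]].
    by apply: n1; exists rho => //; apply/sat_fconj.
  by apply: n2; exists rho => //; apply/sat_fconj.
- move=> p1 p2 q a T _; apply: sound_step; apply: eq_satisfiable_at => rho _.
  by rewrite !sat_fconj /=; tauto.
(* The guard is false in every extension, so the implication holds vacuously and only [q]
   remains. *)
- move=> p1 p2 q a T1 T cl _ sT1 fT1 _; apply: sound_step.
  apply: eq_satisfiable_at => rho ext /=.
  by have := unsat_guard _ _ rho _ sT1 fT1 ext; tauto.
(* The guard is true in every extension, so the implication amounts to [p2]. *)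
- move=> p1 p2 q a T1 T cl _ sT1 scT1 _; apply: sound_step.
  apply: eq_satisfiable_at => rho ext; rewrite sat_fconj /=.
  by have := sat_guard _ _ rho _ cl sT1 scT1 ext; tauto.
- by move=> *; apply: sound_error.
- by move=> *; apply: sound_error.
- move=> p q a T1 T cl _ sT1 fT1 _; apply: sound_step.
  apply: eq_satisfiable_at => rho ext /=.
  by have := unsat_guard _ _ rho _ sT1 fT1 ext; tauto.
- move=> p q a T1 cl _ sT1 scT1; apply: sound_fail => -[rho ext /= [np _]].
  exact: np (sat_guard _ _ rho _ cl sT1 scT1 ext).
- by move=> *; apply: sound_error.
- by move=> *; apply: sound_error.
- by move=> x y p q a T ya yq yp _; apply: sound_step; apply: satisfiable_at_Ex.
Qed.

End Valuations.

Theorem theorem2 (S : signature) (I : interpretation S) (p : formula S)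
    (a : valuation I) (T : tree S I) :
  comp_tree p a T -> determined T ->
  (true_in (name_interp I) (ex_closure (inst a p)) -> successful T) /\
  (~ true_in (name_interp I) (ex_closure (inst a p)) -> failed T).
Proof.
move=> /comp_tree_sound[sT fT]; rewrite true_in_closure_inst.
(* In each case one conclusion is immediate, and soundness contradicts the premise of the other. *)
by case=> [sucT|failT]; split=> //; [case; apply: sT|move/(fT failT)].
Qed.
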